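(* Let $G$ be a connected graph of order $n$ with independence number $\alpha(G)$. Then $$m_{D^{L}(G)}[n,n+\alpha(G))\leq n-\alpha(G).$$ For $\alpha(G)=1$ or $\alpha(G)=n-1$, equality holds if and only if $G\cong K_n$ or $G\cong S_n$. Moreover, for all integers $n$ and $\alpha$ with $2\leq \alpha\leq n-2$, the bound is sharp: the graph $SK_{n,\alpha}$ (which has order $n$ and independence number $\alpha$) attains equality.
   Context: All graphs are finite, simple and connected. $K_n$ is the complete graph and $S_n$ the star graph on $n$ vertices. $SK_{n,\alpha}$ is the complete split graph, i.e. the complement of the disjoint union of a clique $K_\alpha$ and $n-\alpha$ isolated vertices. For a connected graph $G$ with vertex set $\{v_1,\dots,v_n\}$, $d_{uv}$ is the length of a shortest path between $u$ and $v$, $D(G)=(d_{uv})$ is the distance matrix, $Tr(v)=\sum_{u\in V(G)}d_{uv}$ is the transmission of $v$, and the distance Laplacian matrix is $D^L(G)=\mathrm{diag}(Tr(v_1),\dots,Tr(v_n))-D(G)$. Its eigenvalues (all real) are the distance Laplacian eigenvalues of $G$. For an interval $I\subseteq\mathbb{R}$, $m_{D^L(G)}I$ denotes the number of distance Laplacian eigenvalues of $G$, counted with multiplicity, lying in $I$. *)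

(* Defs.v *)
From HB Require Import structures.
From mathcomp Require Import all_boot all_order all_algebra.
From mathcomp Require Import polyrcf reals.

Set Implicit Arguments.
Unset Strict Implicit.
Unset Printing Implicit Defensive.

Import Order.TTheory GRing.Theory Num.Theory.

Local Open Scope ring_scope.

Record sgraph (n : nat) := SGraph {
  adj : rel 'I_n;
  adj_sym : symmetric adj;
  adj_irrefl : irreflexive adj }.

Section Graphs.
Variable n : nat.
Implicit Types G H : sgraph n.

Definition connected_graph G : bool := [forall u, forall v, connect (adj G) u v].

Definition graph_iso G H : Prop :=
  exists2 f : 'I_n -> 'I_n, bijective f &
    forall u v, adj H (f u) (f v) = adj G u v.

Definition independent G (A : {set 'I_n}) : bool :=
  [forall u in A, forall v in A, ~~ adj G u v].

Definition independence_number G : nat :=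
  \max_(A : {set 'I_n} | independent G A) #|A|.

(* A path of length k from u to v, given by its vertices after u; all of its
   vertices are distinct. *)
Definition has_path G (u v : 'I_n) (k : nat) : bool :=
  [exists p : k.-tuple 'I_n,
    [&& path (adj G) u p, last u p == v & uniq (u :: p)]].

(* The least k < n such that there is a path of length k from u to v; the value
   is n when u and v are in different components. *)
Definition dist G (u v : 'I_n) : nat := find (has_path G u v) (iota 0 n).

Definition transmission G (v : 'I_n) : nat := (\sum_(u < n) dist G u v)%N.

Definition distance_matrix (R : nzRingType) G : 'M[R]_n :=
  \matrix_(u, v) (dist G u v)%:R.

Definition distance_laplacian (R : nzRingType) G : 'M[R]_n :=
  diag_mx (\row_v (transmission G v)%:R) - distance_matrix R G.

Lemma compl_sym G : symmetric (fun u v => (u != v) && ~~ adj G u v).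
Proof. by move=> u v; rewrite eq_sym adj_sym. Qed.

Lemma compl_irrefl G : irreflexive (fun u v => (u != v) && ~~ adj G u v).
Proof. by move=> u; rewrite eqxx. Qed.

Definition compl_graph G : sgraph n := SGraph (compl_sym G) (compl_irrefl G).

End Graphs.

(* Number of eigenvalues of A in I, counted with their multiplicity as roots of
   the characteristic polynomial; rootsR lists its distinct roots. *)
Definition eigen_count (R : rcfType) (n : nat) (A : 'M[R]_n) (I : interval R) :
    nat :=
  (\sum_(x <- rootsR (char_poly A) | x \in I) mup x (char_poly A))%N.

Section Families.
Variable n : nat.

Lemma complete_sym : symmetric (fun u v : 'I_n => u != v).
Proof. by move=> u v; rewrite eq_sym. Qed.

Lemma complete_irrefl : irreflexive (fun u v : 'I_n => u != v).
Proof. by move=> u; rewrite eqxx. Qed.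

Definition complete_graph : sgraph n := SGraph complete_sym complete_irrefl.

(* The centre of the star is the vertex 0. *)
Lemma star_sym :
  symmetric (fun u v : 'I_n => (u != v) && ((val u == 0%N) || (val v == 0%N))).
Proof. by move=> u v; rewrite eq_sym orbC. Qed.

Lemma star_irrefl :
  irreflexive (fun u v : 'I_n => (u != v) && ((val u == 0%N) || (val v == 0%N))).
Proof. by move=> u; rewrite eqxx. Qed.

Definition star_graph : sgraph n := SGraph star_sym star_irrefl.

(* For a <= n: the disjoint union of a clique on the vertices 0, ..., a - 1 and
   the isolated vertices a, ..., n - 1. *)
Lemma clique_isolated_sym (a : nat) :
  symmetric (fun u v : 'I_n => [&& u != v, (u < a)%N & (v < a)%N]).
Proof. by move=> u v; rewrite eq_sym [(u < a)%N && _]andbC. Qed.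

Lemma clique_isolated_irrefl (a : nat) :
  irreflexive (fun u v : 'I_n => [&& u != v, (u < a)%N & (v < a)%N]).
Proof. by move=> u; rewrite eqxx. Qed.

Definition clique_isolated (a : nat) : sgraph n :=
  SGraph (clique_isolated_sym a) (clique_isolated_irrefl a).

Definition complete_split_graph (a : nat) : sgraph n :=
  compl_graph (clique_isolated a).

End Families.

(* Main.v *)
(** The proof compares two subspaces. For an independent set A of size a, let V be
    the a-dimensional space of vectors x that take a constant value c off A and
    satisfy sum_(v in A) (x_v - c) = 0, and let W be spanned by the eigenvectors
    whose eigenvalue lies in [n, n + a). These eigenvalues are nonzero, so W is
    orthogonal to the all-one vector; a vector of V orthogonal to it vanishes off A
    and has sum zero. The form sum_{u<v} d_uv |x_u - x_v|^2 of such a vector is at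
    least (n + a)|x|^2, because distances are at least 2 inside A and at least 1
    elsewhere, while on W \ {0} it is smaller than (n + a)|x|^2. Hence V and W meet
    trivially and dim W <= n - a.

    If all pairs not contained in A are adjacent, then D^L - n I has rank at most a,
    so n is an eigenvalue of multiplicity at least n - a. This covers the complete
    split graphs, and also every connected graph with independence number 1 or
    n - 1: such a graph is complete or a star, so that both sides of the
    characterization of equality then hold. *)

Require Import Defs.
From mathcomp Require Import all_boot all_order all_algebra.
From mathcomp Require Import reals.
From mathcomp Require Import perm polyrcf complex ring.

Set Implicit Arguments.
Unset Strict Implicit.
Unset Printing Implicit Defensive.

Import Order.TTheory GRing.Theory Num.Theory.

Local Open Scope ring_scope.

(** * Eigenvalue counts from a spectral decomposition *)

Lemma mup_prod_XsubC (F : fieldType) (I : finType) (r : I -> F) x :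
  mup x (\prod_i ('X - (r i)%:P)) = (\sum_i (r i == x))%N.
Proof.
(* Nonvanishing is carried along the induction, since multiplicities add up only over nonzero
   factors. *)
pose K (p : {poly F}) k := p != 0 /\ mup x p = k.
suff [] : K (\prod_i ('X - (r i)%:P)) (\sum_i (r i == x))%N by [].
apply: (big_ind2 K) => [|p k q l [p0 <-] [q0 <-]|i _].
- by split; [exact: oner_neq0 | rewrite mupNroot // root1].
- by split; [rewrite mulf_neq0 | rewrite mupM].
- split; first by rewrite polyXsubC_eq0.
  by rewrite -['X - _]expr1 mup_XsubCX; case: eqP.
Qed.

(** Writing each multiplicity as a count of indices and exchanging the two sums, an index [i]
    contributes 1 exactly when [r i] lies in [I], because [r i] occurs once among the distinct
    roots. *)
Lemma eigen_count_prod_XsubC (R : rcfType) n (A : 'M[R]_n) (r : 'I_n -> R) I :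
    char_poly A = \prod_i ('X - (r i)%:P) ->
  eigen_count A I = #|[set i | r i \in I]|.
Proof.
rewrite /eigen_count => ->; set p := \prod_i _.
have p0 : p != 0 by rewrite monic_neq0 // monic_prod_XsubC.
under eq_bigr do rewrite mup_prod_XsubC.
rewrite exchange_big /= -sum1dep_card [RHS]big_mkcond /=; apply: eq_bigr => i _.
rewrite -big_filter.
have -> : (\sum_(x <- [seq x <- rootsR p | x \in I]) (r i == x) =
   count_mem (r i) [seq x <- rootsR p | x \in I])%N.
  rewrite -sum1_count [RHS]big_mkcond; apply: eq_bigr => x _ /=.
  by rewrite eq_sym; case: eqP.
rewrite count_uniq_mem ?filter_uniq ?uniq_roots // mem_filter.
rewrite -roots_on_rootsR // inE /=.
suff -> : root p (r i) by rewrite andbT; case: (r i \in I).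
by rewrite /root horner_prod (bigD1 i) //= hornerXsubC subrr mul0r.
Qed.

Lemma char_poly_conj (F : fieldType) n (P A : 'M[F]_n) :
  P \in unitmx -> char_poly (invmx P *m A *m P) = char_poly A.
Proof.
move=> Pu; rewrite /char_poly.
have -> : char_poly_mx (invmx P *m A *m P) =
    map_mx polyC (invmx P) *m char_poly_mx A *m map_mx polyC P.
  rewrite /char_poly_mx mulmxBr mulmxBl -!map_mxM /= mul_mx_scalar -scalemxAl.
  by rewrite -map_mxM mulVmx // map_mx1 scalemx1.
rewrite !det_mulmx mulrAC -det_mulmx -map_mxM mulVmx // map_mx1 det1 mul1r //.
Qed.

(** The matrix is diagonalized as a Hermitian matrix over [R[i]]. Its eigenvalues are real, so the
    diagonal descends to [R] while [P] stays complex; the rows of [P] are left eigenvectors of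
    [A]. *)
Lemma symmetric_spectral (R : rcfType) n (A : 'M[R]_n) : A^T = A ->
  exists (P : 'M[R[i]]_n) (r : 'rV[R]_n), P \is unitarymx /\
    map_mx (real_complex R) A =
      invmx P *m diag_mx (map_mx (real_complex R) r) *m P.
Proof.
move=> Asym; set B := map_mx _ A.
have Bh : B \is hermsymmx.
  apply: realsym_hermsym.
    apply/is_hermitianmxP; rewrite expr0 scale1r.
    by apply/matrixP => i j; rewrite /B -{1}Asym !mxE.
  by apply/mxOverP => i j; rewrite mxE complex_real.
exists (spectralmx B), (map_mx (@complex.Re R) (spectral_diag B)).
split; first exact: spectral_unitarymx.
have -> : map_mx (real_complex R) (map_mx (@complex.Re R) (spectral_diag B)) =
    spectral_diag B.
  apply/matrixP=> i j; rewrite !mxE RRe_real //.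
  exact/mxOverP/hermitian_spectral_diag_real.
exact/orthomx_spectralP/hermitian_normalmx.
Qed.

Lemma char_poly_spectral (R : rcfType) n (A : 'M[R]_n) (P : 'M[R[i]]_n)
    (r : 'rV[R]_n) :
    P \is unitarymx ->
    map_mx (real_complex R) A =
      invmx P *m diag_mx (map_mx (real_complex R) r) *m P ->
  char_poly A = \prod_i ('X - (r 0 i)%:P).
Proof.
move=> Pu defA; apply: (map_poly_inj (real_complex R)).
rewrite map_char_poly defA char_poly_conj ?unitarymx_unit //.
rewrite char_poly_trig ?diag_mx_is_trig // rmorph_prod; apply: eq_bigr => i _.
by rewrite rmorphB /= map_polyX map_polyC !mxE eqxx mulr1n.
Qed.

(** * Small values of the distance *)

Section Distance.
Variable n : nat.
Implicit Types (G : sgraph n) (u v : 'I_n).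

Lemma has_path_sym G u v k : has_path G u v k -> has_path G v u k.
Proof.
case/existsP=> p /and3P[ep /eqP lp up].
have sz : size (rev (belast u p)) == k by rewrite size_rev size_belast size_tuple.
apply/existsP; exists (Tuple sz) => /=.
have E : v :: rev (belast u p) = rev (u :: p).
  by rewrite [u :: _]lastI lp rev_rcons.
rewrite -[(_ \notin _) && _]/(uniq (v :: rev (belast u p))).
rewrite E rev_uniq up andbT; apply/andP; split.
  rewrite -{1}lp rev_path (eq_path (e' := adj G)) // => x y; exact: adj_sym.
by rewrite -[last _ _]/(last v (v :: rev (belast u p))) E rev_cons last_rcons.
Qed.

Lemma dist_sym G u v : dist G u v = dist G v u.
Proof. by apply: eq_find => k; apply/idP/idP => /has_path_sym. Qed.

Lemma has_path0 G u v : has_path G u v 0 = (u == v).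
Proof.
apply/existsP/idP => [[p]|/eqP <-]; first by rewrite tuple0 /= andbT.
by exists [tuple]; rewrite /= eqxx.
Qed.

Lemma has_path1 G u v : has_path G u v 1 = adj G u v.
Proof.
apply/existsP/idP => [[[[|x [|? ?]] //= _]]|uv].
  by rewrite andbT => /and3P[xv /eqP <-].
exists [tuple v]; rewrite /= uv eqxx !andbT inE.
by apply: contraTneq uv => <-; rewrite adj_irrefl.
Qed.

Lemma has_path2 G u v w : adj G u w -> adj G w v -> u != v -> has_path G u v 2.
Proof.
move=> uw wv neq; apply/existsP; exists [tuple w; v].
rewrite /= uw wv eqxx !inE negb_or neq !andbT /=.
by apply/andP; split; [apply: contraTneq uw|apply: contraTneq wv] => ->;
  rewrite adj_irrefl.
Qed.

Lemma distxx G u : dist G u u = 0%N.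
Proof.
have n_gt0 : (0 < n)%N by apply: leq_ltn_trans (ltn_ord u).
by rewrite /dist -[X in iota 0 X](prednK n_gt0) /= has_path0 eqxx.
Qed.

(** Two distinct vertices force [n] to be at least 2, so the search defining [dist] really tests the
    lengths 0 and 1. *)
Lemma iota_ord_neq u v : u != v -> iota 0 n = [:: 0, 1 & iota 2 (n - 2)]%N.
Proof.
move=> neq; suff n_gt1 : (1 < n)%N by rewrite -[in LHS](subnKC n_gt1).
by move: u v neq; case: n => [[]//|[|//]] u v; rewrite !ord1 eqxx.
Qed.

Lemma dist_gt0 G u v : u != v -> (0 < dist G u v)%N.
Proof.
by move=> neq; rewrite /dist (iota_ord_neq neq) /= has_path0 (negPf neq).
Qed.

Lemma dist_gt1 G u v : u != v -> ~~ adj G u v -> (1 < dist G u v)%N.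
Proof.
move=> neq nadj; rewrite /dist (iota_ord_neq neq) /=.
by rewrite has_path0 has_path1 (negPf neq) (negPf nadj).
Qed.

Lemma dist_adj G u v : adj G u v -> dist G u v = 1%N.
Proof.
move=> uv; have neq : u != v by apply: contraTneq uv => ->; rewrite adj_irrefl.
by rewrite /dist (iota_ord_neq neq) /= has_path0 has_path1 (negPf neq) uv.
Qed.

Lemma dist_common_neighbor G u v w :
  adj G u w -> adj G w v -> u != v -> ~~ adj G u v -> dist G u v = 2%N.
Proof.
move=> uw wv neq nadj; rewrite /dist (iota_ord_neq neq) /=.
rewrite has_path0 has_path1 (negPf neq) (negPf nadj).
(* If [n - 2] is 0, the search list is exhausted and [find] returns its length, which is again 2. *)
by case: (n - 2)%N => //= m; rewrite (has_path2 uw wv neq).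
Qed.
End Distance.

(** * Rank bounds *)

Lemma rank_sum_outer (F : fieldType) n (A : {set 'I_n}) (M : 'M[F]_n)
    (c r : 'I_n -> 'I_n -> F) :
    (forall u v, M u v = \sum_(i in A) c i u * r i v) ->
  (\rank M <= #|A|)%N.
Proof.
move=> defM.
have -> : M = (\matrix_(u < n, k < #|A|) c (enum_val k) u) *m
    (\matrix_(k < #|A|, v < n) r (enum_val k) v).
  apply/matrixP => u v; rewrite defM mxE big_enum_val.
  by apply: eq_bigr => k _; rewrite !mxE.
exact: leq_trans (mxrankM_maxl _ _) (rank_leq_col _).
Qed.

Lemma rank_diag_ge (F : fieldType) n (d : 'rV[F]_n) :
  (#|[set i | d 0%R i != 0%R]| <= \rank (diag_mx d))%N.
Proof.
set B := [set i | _].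
(* [E] selects the rows with nonzero diagonal entry and [N] inverts these entries, so that
   [E *m (diag_mx d *m N)] is the identity of size [#|B|]. *)
pose E := \matrix_(k < #|B|, j < n) (enum_val k == j)%:R : 'M[F]_(#|B|, n).
pose N := \matrix_(j < n, k < #|B|) ((j == enum_val k)%:R / d 0 j) : 'M[F]_(n, #|B|).
have <- : \rank (E *m (diag_mx d *m N)) = #|B|.
  have -> : E *m (diag_mx d *m N) = 1%:M.
    apply/matrixP => k l; rewrite mxE (bigD1 (enum_val k)) //= big1 => [|j].
      rewrite mul_diag_mx !mxE eqxx mul1r addr0.
      rewrite mulrCA divff ?mulr1 ?(inj_eq enum_val_inj) //.
      by have := enum_valP k; rewrite inE.
    by rewrite mxE eq_sym => /negPf ->; rewrite mul0r.
  exact: mxrank1.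
exact: leq_trans (mxrankM_maxr _ _) (mxrankM_maxl _ _).
Qed.

(** * The quadratic form of the distance Laplacian *)

Section Quadratic.
Variables (C : numClosedFieldType).

(** This follows by expanding the squares. It is applied to vectors whose sum over [B] is zero,
    where the last term disappears. *)
Lemma sum_pairs_normC (I : finType) (B : {set I}) (w : I -> C) :
  \sum_(u in B) \sum_(v in B) `|w u - w v| ^+ 2 =
    (#|B|%:R * (\sum_(u in B) `|w u| ^+ 2)) *+ 2 - `|\sum_(u in B) w u| ^+ 2 *+ 2.
Proof.
have E u v : `|w u - w v| ^+ 2 = `|w u| ^+ 2 + `|w v| ^+ 2 - w u * (w v)^* - w v * (w u)^*.
  rewrite !normCK rmorphB; ring.
under eq_bigr do under eq_bigr do rewrite E.
under eq_bigr do rewrite !sumrB !big_split /= sumr_const -mulr_sumr -mulr_suml -!rmorph_sum /=.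
rewrite !sumrB !big_split /= sumr_const -mulr_suml -mulr_sumr -rmorph_sum /=.
rewrite sumrMnl normCK -mulr_natl. ring.
Qed.

(** The factor 2 appears because the sum runs over ordered pairs. After expansion, the symmetry of
    [dist] pairs the diagonal terms ([S1], [S2]) and the cross terms ([T1], [T2]). *)
Lemma laplacian_quadratic n (G : sgraph n) (w : 'rV[C]_n) :
  (w *m distance_laplacian C G *m (map_mx Num.conj w)^T) 0 0 *+ 2 =
    \sum_u \sum_v (dist G u v)%:R * `|w 0 u - w 0 v| ^+ 2.
Proof.
have E u v : `|w 0 u - w 0 v| ^+ 2 =
    `|w 0 u| ^+ 2 + `|w 0 v| ^+ 2 - w 0 u * (w 0 v)^* - w 0 v * (w 0 u)^*.
  rewrite !normCK rmorphB /=; ring.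
under eq_bigr do under eq_bigr do rewrite E mulrBr mulrBr mulrDr.
under eq_bigr do rewrite !sumrB !big_split.
rewrite /= !sumrB !big_split /=.
set S1 := \sum_i \sum_j _ * `|w 0 i| ^+ 2; set S2 := \sum_i \sum_j _ * `|w 0 j| ^+ 2.
set T1 := \sum_i \sum_j _ * (w 0 i * _); set T2 := \sum_i \sum_j _ * (w 0 j * _).
have -> : S2 = S1.
  rewrite /S2 exchange_big /=; apply: eq_bigr => i _.
  by apply: eq_bigr => j _; rewrite dist_sym.
have -> : T2 = T1.
  rewrite /T2 exchange_big /=; apply: eq_bigr => i _.
  by apply: eq_bigr => j _; rewrite dist_sym.
rewrite mulmxBr mulmxBl mxE [in X in _ + X]mxE.
have -> : (w *m diag_mx (\row_v (transmission G v)%:R) *m (map_mx Num.conj w)^T) 0 0 = S1.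
  rewrite mxE; apply: eq_bigr => i _; rewrite mul_mx_diag !mxE normCK.
  rewrite -mulr_suml mulrAC mulrC natr_sum; congr (_ * _).
  by apply: eq_bigr => j _; rewrite dist_sym.
have -> : (w *m distance_matrix C G *m (map_mx Num.conj w)^T) 0 0 = T1.
  rewrite mxE /T1 exchange_big /=; apply: eq_bigr => i _; rewrite !mxE mulr_suml.
  apply: eq_bigr => j _; rewrite !mxE; ring.
ring.
Qed.

Lemma laplacian_quadratic_ge n (G : sgraph n) (A : {set 'I_n}) (w : 'rV[C]_n) :
    independent G A -> (forall v, v \notin A -> w 0 v = 0) -> \sum_v w 0 v = 0 ->
  (n + #|A|)%:R * (\sum_v `|w 0 v| ^+ 2) <=
    (w *m distance_laplacian C G *m (map_mx Num.conj w)^T) 0 0.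
Proof.
move=> indA w0 sw.
rewrite -(ler_pMn2r (ltn0Sn 1)) laplacian_quadratic.
have swA : \sum_(v in A) w 0 v = 0.
  by rewrite -[RHS]sw [LHS]big_mkcond; apply: eq_bigr => v _; case: ifPn => // /w0.
have snA : \sum_(v in A) `|w 0 v| ^+ 2 = \sum_v `|w 0 v| ^+ 2.
  rewrite [LHS]big_mkcond; apply: eq_bigr => v _; case: ifPn => // /w0 ->.
  by rewrite normr0 expr0n.
have := sum_pairs_normC A (w 0); rewrite swA snA normr0 expr0n mul0rn subr0 => EA.
have ET : \sum_u \sum_v `|w 0 u - w 0 v| ^+ 2 = n%:R * (\sum_u `|w 0 u| ^+ 2) *+ 2.
  have inT u : (u \in [set: 'I_n]) = true := in_setT u.
  have := sum_pairs_normC [set: 'I_n] (w 0).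
  rewrite !(eq_bigl _ _ inT) sw normr0 expr0n mul0rn subr0 cardsT card_ord => <-.
  by apply: eq_bigr => u _; apply: eq_bigl => v; rewrite inE.
(* The [n] part is now a sum over all pairs and the [#|A|] part a sum over pairs in [A], so it
   remains to compare termwise: for distinct vertices, [dist] is at least 1, and at least 2 when
   both lie in [A]. *)
rewrite natrD mulrDl mulrnDl -EA -ET [X in _ + X <= _]big_mkcond -big_split.
apply: ler_sum => u _ /=.
have -> : (if u \in A then \sum_(v in A) `|w 0 u - w 0 v| ^+ 2 else 0) =
    \sum_v (if (u \in A) && (v \in A) then `|w 0 u - w 0 v| ^+ 2 else 0).
  by case: (u \in A); [rewrite big_mkcond | rewrite big1].
rewrite -big_split; apply: ler_sum => v _ /=.
have [->|neq] := eqVneq u v; first by rewrite subrr normr0 expr0n /= mulr0 if_same addr0.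
have w_ge0 := exprn_ge0 2 (normr_ge0 (w 0 u - w 0 v)).
case: ifPn => [/andP[uA vA]|_].
  rewrite -{1 2}[_ ^+ 2]mul1r -mulrDl ler_wpM2r // (ler_nat _ 2) dist_gt1 //.
  by move/forall_inP: indA => /(_ u uA)/forall_inP/(_ v vA).
by rewrite addr0 -{1}[_ ^+ 2]mul1r ler_wpM2r // (ler_nat _ 1) dist_gt0.
Qed.
End Quadratic.

(** * Entries and row sums of the distance Laplacian *)

Lemma distance_laplacianE (R : nzRingType) n (G : sgraph n) u v :
  distance_laplacian R G u v =
    (\sum_k (dist G u k)%:R) *+ (u == v) - (dist G u v)%:R.
Proof.
rewrite !mxE natr_sum; congr (_ *+ _ - _).
by apply: eq_bigr => k _; rewrite dist_sym.
Qed.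

Lemma distance_laplacian_sym (R : nzRingType) n (G : sgraph n) :
  (distance_laplacian R G)^T = distance_laplacian R G.
Proof.
apply/matrixP => u v; rewrite mxE !distance_laplacianE dist_sym eq_sym.
by case: eqP => [->|].
Qed.

Lemma map_distance_laplacian (R S : nzRingType) (f : {rmorphism R -> S}) n
    (G : sgraph n) :
  map_mx f (distance_laplacian R G) = distance_laplacian S G.
Proof.
apply/matrixP => u v; rewrite mxE !distance_laplacianE.
rewrite rmorphB rmorphMn rmorph_sum rmorph_nat; congr (_ *+ _ - _).
by apply: eq_bigr => k _; rewrite rmorph_nat.
Qed.

Lemma distance_laplacian_row_sum (R : nzRingType) n (G : sgraph n) u :
  \sum_v distance_laplacian R G u v = 0.
Proof.
under eq_bigr do rewrite distance_laplacianE.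
rewrite sumrB [X in X - _](bigD1 u) //= eqxx [X in _ + X - _]big1 => [|v].
  by rewrite addr0 subrr.
by rewrite eq_sym => /negPf ->.
Qed.

(** * The upper bound *)

Lemma eigen_count_le (R : rcfType) n (G : sgraph n) (A : {set 'I_n}) :
    independent G A -> (0 < #|A|)%N ->
  (eigen_count (distance_laplacian R G) `[n%:R, (n + #|A|)%:R[ <= n - #|A|)%N.
Proof.
move=> indA A_gt0; set a := #|A|.
have n_gt0 : (0 < n)%N by rewrite (leq_trans A_gt0) // -[X in (_ <= X)%N]card_ord max_card.
have [P [r [Pu]]] := symmetric_spectral (distance_laplacian_sym R G).
move=> defL; rewrite (eigen_count_prod_XsubC _ (char_poly_spectral Pu defL)).
rewrite map_distance_laplacian in defL; set L := distance_laplacian _ _ in defL.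
set I := Interval _ _; set S := [set i | r 0 i \in I].
have Pun := unitarymx_unit Pu.
have PPt : P *m (map_mx Num.conj P)^T = 1%:M.
  by rewrite map_trmx; apply/unitarymxP.
rewrite leq_subRL; last by rewrite -[X in (_ <= X)%N]card_ord max_card.
rewrite addnC.
(* The row space of [diag_mx dS *m P] is the span W of the eigenvectors with eigenvalue in the
   interval. The nonzero rows of [V] are the unit vectors of [A], each extended by the constant
   [1 / a] off [A]; thus the value off [A] is the mean over [A]. *)
pose dS : 'rV[R[i]]_n := \row_i (i \in S)%:R.
pose dA : 'rV[R[i]]_n := \row_i (i \in A)%:R.
pose V : 'M[R[i]]_n :=
  \matrix_(i, v) (if i \in A then (i == v)%:R + (v \notin A)%:R / a%:R else 0).
have rankS : (#|S| <= \rank (diag_mx dS *m P))%N.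
  rewrite mxrankMfree; last by rewrite row_free_unit unitarymx_unit.
  apply: leq_trans (rank_diag_ge _); apply/subset_leq_card/subsetP => i iS.
  by rewrite inE mxE iS oner_eq0.
have rankA : (a <= \rank V)%N.
  (* Restricting the rows of [V] to the coordinates in [A] leaves the unit vectors of [A]. *)
  apply: leq_trans (mxrankM_maxl V (diag_mx dA)).
  have -> : V *m diag_mx dA = diag_mx dA.
    apply/matrixP => i v; rewrite mul_mx_diag !mxE.
    have [->|_] := eqVneq i v.
      by case: (v \in A); rewrite /= ?mul0r ?addr0 ?mulr1.
    by case: (v \in A); rewrite /= ?mulr0 ?mul0r ?addr0 ?if_same ?mul0r.
  apply: leq_trans (rank_diag_ge _); apply/subset_leq_card/subsetP => i iA.
  by rewrite inE mxE iA oner_eq0.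
suff cap0 : (diag_mx dS *m P :&: V)%MS = 0.
  apply: leq_trans (leq_add rankS rankA) _.
  by rewrite -(mxrank_disjoint_sum cap0) rank_leq_col.
apply/eqP/rowV0P => w; rewrite sub_capmx => /andP[/submxP[y wS] /submxP[z wA]].
pose x := y *m diag_mx dS.
have wE : w = x *m P by rewrite wS mulmxA.
have r_ge i : i \in S -> n%:R <= r 0 i < (n + a)%:R.
  by rewrite inE /I in_itv.
have x0 i : i \notin S -> x 0 i = 0.
  by move=> iS; rewrite /x mul_mx_diag !mxE (negPf iS) mulr0.
clearbody x.
(* Eigenvalues in the interval are at least [n > 0]. Dividing the coordinates of [x] by them
   exhibits [w] in the row space of [L], whose rows sum to zero. *)
have sw : \sum_v w 0 v = 0.
  pose x' : 'rV[R[i]]_n := \row_i (x 0 i / (real_complex R (r 0 i))).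
  have -> : w = x' *m P *m L.
    rewrite wE defL !mulmxA (mulmxK Pun); congr (_ *m _).
    apply/rowP => i; rewrite mul_mx_diag !mxE.
    have [iS|iS] := boolP (i \in S); last by rewrite x0 // !mul0r.
    rewrite divfK // fmorph_eq0 gt_eqF //.
    by have /andP[+ _] := r_ge i iS; apply: lt_le_trans; rewrite ltr0n.
  under eq_bigr do rewrite mxE.
  rewrite exchange_big big1 //= => u _.
  by rewrite -mulr_sumr distance_laplacian_row_sum mulr0.
have wv v : w 0 v = if v \in A then z 0 v else (\sum_(i in A) z 0 i) / a%:R.
  rewrite wA mxE; case: ifPn => vA.
    rewrite (bigD1 v) //= big1 => [|i /negPf iv]; rewrite !mxE.
      by rewrite vA eqxx mul0r !addr0 mulr1.
    by rewrite iv vA mul0r addr0; case: ifP; rewrite mulr0.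
  rewrite mulr_suml [RHS]big_mkcond; apply: eq_bigr => i _; rewrite mxE.
  case: ifP => iA; last by rewrite mulr0.
  have -> : (i == v) = false by apply: contraNF vA => /eqP <-.
  by rewrite add0r vA mul1r.
(* With [s] the sum of [z] over [A], the total of [w] is [s * (1 + (n - a) / a)]. The second factor
   is positive, so [s] vanishes, and with it the value [s / a] off [A]. *)
have w0 v : v \notin A -> w 0 v = 0.
  move=> vA; rewrite wv (negPf vA); apply/eqP; rewrite mulf_eq0; apply/orP; left.
  have := sw; rewrite (bigID (mem A)) /=.
  rewrite (eq_bigr (z 0)) => [|i iA]; last by rewrite wv iA.
  rewrite [X in _ + X](eq_bigr (fun=> (\sum_(i in A) z 0 i) / a%:R)) => [|i iA]; last first.
    by rewrite wv (negPf iA).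
  rewrite sumr_const => /eqP.
  rewrite -mulrnAr -[X in X + _]mulr1 -mulrDr mulf_eq0 => /orP[//|].
  by rewrite gt_eqF // ltr_wpDr ?ltr01 // mulrn_wge0 // invr_ge0 ler0n.
have := laplacian_quadratic_ge indA w0 sw.
have -> : \sum_v `|w 0 v| ^+ 2 = \sum_i `|x 0 i| ^+ 2.
  have nE (q : 'rV[R[i]]_n) : \sum_v `|q 0 v| ^+ 2 = (q *m (map_mx Num.conj q)^T) 0 0.
    by rewrite mxE; apply: eq_bigr => v _; rewrite !mxE normCK.
  rewrite !nE wE map_mxM trmx_mul mulmxA -[x *m P *m _]mulmxA.
  by rewrite PPt mulmx1.
have -> : (w *m L *m (map_mx Num.conj w)^T) 0 0 =
    \sum_i (real_complex R (r 0 i)) * `|x 0 i| ^+ 2.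
  rewrite wE map_mxM trmx_mul defL !mulmxA (mulmxK Pun).
  rewrite -[_ *m P *m _]mulmxA PPt mulmx1 mxE; apply: eq_bigr => i _.
  by rewrite mul_mx_diag !mxE normCK; ring.
(* The lower bound on the form makes the sum of [((n + a) - r i) * |x i|^2] nonpositive, while
   [r i < n + a] on [S] makes every term nonnegative. Hence all terms vanish, and strictness gives
   [x = 0]. *)
rewrite mulr_sumr -subr_ge0 -sumrB => sum_ge0.
have x_le0 i : 0 <= ((n + a)%:R - real_complex R (r 0 i)) * `|x 0 i| ^+ 2.
  have [iS|iS] := boolP (i \in S); last by rewrite x0 // normr0 expr0n mulr0.
  rewrite mulr_ge0 ?exprn_ge0 // subr_ge0 -(rmorph_nat (real_complex R)) lecR ltW //.
  by have /andP[] := r_ge i iS.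
suff x_eq0 : x = 0 by rewrite wE x_eq0 mul0mx.
apply/rowP => i; rewrite [RHS]mxE; have [iS|/x0 //] := boolP (i \in S).
have /psumr_eq0P : \sum_i ((n + a)%:R - real_complex R (r 0 i)) * `|x 0 i| ^+ 2 = 0.
  apply/eqP; rewrite eq_le sumr_ge0 // andbT -oppr_ge0 -sumrN.
  by under eq_bigr do rewrite mulrBl opprB.
move=> /(_ (fun i _ => x_le0 i) i isT) /eqP.
rewrite mulf_eq0 expf_eq0 normr_eq0 /= => /orP[|/eqP //].
rewrite subr_eq0 -(rmorph_nat (real_complex R)) gt_eqF // ltcR.
by have /andP[] := r_ge i iS.
Qed.

(** * The lower bound when all pairs not contained in [A] are adjacent *)

Lemma eigen_count_ge (R : rcfType) n (G : sgraph n) (A : {set 'I_n}) :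
    independent G A -> (0 < #|A| < n)%N ->
    (forall u v, u != v -> ~~ ((u \in A) && (v \in A)) -> adj G u v) ->
  (n - #|A| <= eigen_count (distance_laplacian R G) `[n%:R, (n + #|A|)%:R[)%N.
Proof.
move=> indA /andP[A_gt0 A_lt] adjG; set a := #|A|.
have [P [r [Pu defL]]] := symmetric_spectral (distance_laplacian_sym R G).
rewrite (eigen_count_prod_XsubC _ (char_poly_spectral Pu defL)).
rewrite map_distance_laplacian in defL; set L := distance_laplacian _ _ in defL.
(* A vertex outside [A] is a common neighbor of any two vertices of [A], which are therefore at
   distance exactly 2. *)
have [c cA] : exists c, c \notin A.
  apply/existsP; apply: contraTT A_lt => /existsPn /= allA.
  rewrite -leqNgt -[X in (X <= _)%N]card_ord.
  by apply/subset_leq_card/subsetP => v _; rewrite -[_ \in _]negbK.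
have distE u v : (dist G u v)%:R =
    (1 + (u \in A)%:R * (v \in A)%:R) * (1 - (u == v)%:R) :> R[i].
  have [->|neq] := eqVneq u v; first by rewrite distxx subrr mulr0.
  rewrite subr0 mulr1; have [/andP[uA vA]|uvA] := boolP ((u \in A) && (v \in A)).
    have nadj : ~~ adj G u v.
      by move/forall_inP: indA => /(_ u uA)/forall_inP/(_ v vA).
    have nc w : w \in A -> (w != c) by move=> wA; apply: contraNneq cA => <-.
    rewrite (@dist_common_neighbor _ G u v c) ?uA ?vA ?mulr1 //; apply: adjG.
    - exact: nc.
    - by rewrite (negPf cA) andbF.
    - by rewrite eq_sym nc.
    - by rewrite (negPf cA).
  rewrite dist_adj ?adjG // -natrM mulnb (negPf uvA) addr0 //.
have LE u v : L u v = n%:R * (u == v)%:R - 1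
    + (u \in A)%:R * (v \in A)%:R * (a%:R * (u == v)%:R - 1).
  have delta_sum : \sum_k (u == k)%:R = 1 :> R[i].
    rewrite (bigD1 u) //= eqxx big1 ?addr0 // => k.
    by rewrite eq_sym => /negPf ->.
  have indic_sum : \sum_k (k \in A)%:R = a%:R :> R[i].
    by rewrite -natr_sum /a -sum1_card [in RHS]big_mkcond.
  have distE' k : (dist G u k)%:R = 1 + (u \in A)%:R * (k \in A)%:R
      - (1 + (u \in A)%:R) * (u == k)%:R :> R[i].
    rewrite distE; have [->|_] := eqVneq u k; last by rewrite !subr0 mulr0 subr0 mulr1.
    by rewrite -natrM mulnb andbb; ring.
  have tr : \sum_k (dist G u k)%:R
      = n%:R + (u \in A)%:R * a%:R - (1 + (u \in A)%:R) :> R[i].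
    under eq_bigr do rewrite distE'.
    rewrite sumrB big_split /= -!mulr_sumr delta_sum indic_sum mulr1.
    by rewrite sumr_const card_ord.
  rewrite distance_laplacianE tr distE'; have [->|_] := eqVneq u v.
    by case: (v \in A); rewrite /=; ring.
  by rewrite /=; ring.
have rankL : (\rank (L - n%:R%:M)%R <= a)%N.
  (* On A, a I - J is a times a projection whose kernel is spanned by 1_A, so
     the all-one matrix J can be absorbed without a further rank-one term. *)
  pose cf i u : R[i] := a%:R * (u == i)%:R - (u \in A)%:R - 1.
  pose rf i v : R[i] := (i == v)%:R + (v \notin A)%:R / a%:R.
  have a0 : a%:R != 0 :> R[i] by rewrite pnatr_eq0 -lt0n.
  apply: (@rank_sum_outer _ _ _ _ cf rf) => u v.
  rewrite mxE LE !mxE /cf /rf.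
  (* For [v] in [A], column [v] is [cf v]. For [v] outside [A], it is the mean of the [cf i] over
     [A], which is constantly -1. *)
  have [vA|vA] := boolP (v \in A).
    rewrite (bigD1 v) //= big1 => [|i /andP[_ /negPf ->]].
      rewrite eqxx /=; have [->|_] := eqVneq u v; last by rewrite /=; ring.
      by rewrite vA /=; ring.
    by rewrite mul0r addr0 mulr0.
  under eq_bigr => i iA.
    have -> : (i == v) = false by apply: contraNF vA => /eqP <-.
    rewrite add0r mul1r; over.
  rewrite -mulr_suml !sumrB !sumr_const -mulr_sumr.
  have -> : \sum_(i in A) (u == i)%:R = (u \in A)%:R :> R[i].
    have [uA|uA] := boolP (u \in A).
      rewrite (bigD1 u) //= eqxx big1 ?addr0 // => i /andP[_].
      by rewrite eq_sym => /negPf ->.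
    by rewrite big1 // => i iA; have [ui|//] := eqVneq u i; rewrite ui iA in uA.
  by rewrite -/a; case: (u \in A); have [_|_] := eqVneq u v; rewrite /=; field.
pose d : 'rV[R[i]]_n := \row_i (real_complex R (r 0 i) - n%:R).
have LdE : L - n%:R%:M = invmx P *m diag_mx d *m P.
  have -> : diag_mx d = diag_mx (map_mx (real_complex R) r) - n%:R%:M.
    by apply/matrixP => i j; rewrite !mxE mulrnBl.
  rewrite mulmxBr mulmxBl -defL mul_mx_scalar -scalemxAl.
  by rewrite mulVmx ?unitarymx_unit // scalemx1.
have rank_d : (#|[set i | d 0%R i != 0%R]| <= a)%N.
  apply: leq_trans (rank_diag_ge _) _; apply: leq_trans rankL.
  have -> : diag_mx d = P *m (L - n%:R%:M) *m invmx P.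
    have Pun := unitarymx_unit Pu.
    by rewrite LdE !mulmxA (mulmxK Pun) (mulmxV Pun) mul1mx.
  exact: leq_trans (mxrankM_maxl _ _) (mxrankM_maxr _ _).
(* At most [a] of the [r i] differ from [n]. The others equal [n], which belongs to the half-open
   interval because [a > 0]. *)
rewrite leq_subLR -[X in (X <= _)%N]card_ord -(cardsC [set i | d 0%R i != 0%R]).
apply: leq_add => //; apply/subset_leq_card/subsetP => i.
rewrite 3!inE negbK mxE subr_eq0 -(rmorph_nat (real_complex R)).
rewrite (inj_eq (fmorph_inj _)) => /eqP ->.
by rewrite in_itv /= lexx ltr_nat -[X in (X < _)%N]addn0 ltn_add2l.
Qed.

(** * Independent sets and the extremal independence numbers *)

Lemma independentP n (G : sgraph n) (A : {set 'I_n}) :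
  reflect {in A &, forall u v, ~~ adj G u v} (independent G A).
Proof.
apply: (iffP forall_inP) => [indA u v uA vA | indA u uA].
  by move/forall_inP: (indA u uA) => /(_ v vA).
by apply/forall_inP => v vA; apply: indA.
Qed.

Lemma independent_set1 n (G : sgraph n) u : independent G [set u].
Proof. by apply/independentP => x y /set1P-> /set1P->; rewrite adj_irrefl. Qed.

Lemma independence_number_attained n (G : sgraph n) :
  exists2 A, independent G A & #|A| = independence_number G.
Proof.
have ind0 : (0 < #|[pred A | independent G A]|)%N.
  by apply/card_gt0P; exists set0; apply/independentP => u v; rewrite inE.
by have [A indA eqA] := eq_bigmax_cond (fun A : {set 'I_n} => #|A|) ind0; exists A.
Qed.

Lemma leq_independence_number n (G : sgraph n) (A : {set 'I_n}) :
  independent G A -> (#|A| <= independence_number G)%N.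
Proof. exact: bigop.leq_bigmax_cond. Qed.

Lemma independence_number_gt0 n (G : sgraph n) :
  (0 < n)%N -> (0 < independence_number G)%N.
Proof.
move=> n_gt0; rewrite -(cards1 (Ordinal n_gt0)).
exact/leq_independence_number/independent_set1.
Qed.

(** Two distinct nonadjacent vertices would form an independent set of size 2. *)
Lemma independence_number1_adj n (G : sgraph n) u v :
  independence_number G = 1%N -> adj G u v = (u != v).
Proof.
move=> alpha1; have [<-|neq] := eqVneq u v; first exact: adj_irrefl.
apply: contra_eqT alpha1 => nadj; rewrite gtn_eqF //.
apply: leq_trans (leq_independence_number (A := [set u; v]) _).
  by rewrite cards2 neq.
by apply/independentP => x y /set2P[]-> /set2P[]->;
  rewrite ?adj_irrefl // adj_sym.
Qed.

(** Every vertex other than [c] lies in [A]. The first edge of a path from such a vertex to [c]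
    cannot end in [A], so it ends at [c]. *)
Lemma adj_compl_set1 n (G : sgraph n) (A : {set 'I_n}) c :
    connected_graph G -> independent G A -> ~: A = [set c] ->
  forall u v, adj G u v = (u != v) && ((u == c) || (v == c)).
Proof.
move=> /forallP conG /independentP indA Ac.
have inA u : (u \in A) = (u != c) by rewrite -[_ == c]in_set1 -Ac inE negbK.
have adjc u : u != c -> adj G u c.
  move=> uc; have /forallP/(_ c)/connectP[[|x p] /=] := conG u.
    by move=> _ cu; rewrite cu eqxx in uc.
  case/andP=> ux _ _; have [<- //|xc] := eqVneq x c.
  by have := indA u x; rewrite !inA ux => /(_ uc xc).
move=> u v; have [<-|neq] := eqVneq u v; first exact: adj_irrefl.
have [uc|uc] := eqVneq u c.
  by rewrite uc adj_sym adjc // -uc eq_sym.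
have [->|vc] := eqVneq v c; first exact: adjc.
by apply: negbTE; apply: indA; rewrite inA.
Qed.

Lemma star_iso n (G : sgraph n) c :
    (forall u v, adj G u v = (u != v) && ((u == c) || (v == c))) ->
  graph_iso G (star_graph n).
Proof.
move=> adjE; have n_gt0 : (0 < n)%N by apply: leq_ltn_trans (ltn_ord c).
(* The transposition moves the center [c] to the vertex 0, the center of [star_graph]. *)
pose f := tperm c (Ordinal n_gt0).
have f0 u : (val (f u) == 0%N) = (u == c).
  by rewrite -(inj_eq (@perm_inj _ f)) tpermL -val_eqE.
exists f => [|u v]; first by exists (f^-1)%g; [exact: permK | exact: permKV].
by rewrite /= (inj_eq (@perm_inj _ f)) !f0 adjE.
Qed.

Lemma eigen_count_complete_off (R : rcfType) n (G : sgraph n) (A : {set 'I_n}) :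
    independent G A -> (0 < #|A| < n)%N ->
    (forall u v, u != v -> ~~ ((u \in A) && (v \in A)) -> adj G u v) ->
  eigen_count (distance_laplacian R G) `[n%:R, (n + #|A|)%:R[ = (n - #|A|)%N.
Proof.
move=> indA A_bnd adjG; apply/eqP; rewrite eqn_leq eigen_count_ge // andbT.
by case/andP: A_bnd => A_gt0 _; apply: eigen_count_le.
Qed.

(** * Complete split graphs *)

Lemma complete_split_adj n a (u v : 'I_n) :
  adj (complete_split_graph n a) u v = (u != v) && ~~ ((u < a)%N && (v < a)%N).
Proof. by rewrite /=; case: (u != v). Qed.

Lemma card_ltn_ord n a : (a <= n)%N -> #|[set u : 'I_n | (u < a)%N]| = a.
Proof.
move=> a_le; rewrite -sum1dep_card -(big_ord_widen n (fun=> 1%N) a_le).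
by rewrite sum1_card card_ord.
Qed.

Lemma complete_split_indep n a :
  independent (complete_split_graph n a) [set u : 'I_n | (u < a)%N].
Proof.
by apply/independentP => u v; rewrite !inE complete_split_adj => -> ->; rewrite andbF.
Qed.

Lemma complete_split_connected n a : (a < n)%N ->
  connected_graph (complete_split_graph n a).
Proof.
(* The vertex numbered [a] is the first one outside the independent set, hence adjacent to all
   others. *)
move=> a_lt; pose c := Ordinal a_lt.
have toc u : connect (adj (complete_split_graph n a)) u c.
  have [->|neq] := eqVneq u c; first exact: connect0.
  by apply: connect1; rewrite complete_split_adj neq /= ltnn andbF.
apply/forallP => u; apply/forallP => v; apply: connect_trans (toc u) _.
by rewrite (sym_connect_sym (@adj_sym _ _)).
Qed.

(** An independent set not contained in the first [a] vertices has a vertex adjacent to all others,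
    so it is a singleton. *)
Lemma complete_split_independence_number n a : (0 < a <= n)%N ->
  independence_number (complete_split_graph n a) = a.
Proof.
case/andP=> a_gt0 a_le; apply/eqP; rewrite eqn_leq; apply/andP; split; last first.
  rewrite -[X in (X <= _)%N](card_ltn_ord a_le).
  exact/leq_independence_number/complete_split_indep.
apply/bigop.bigmax_leqP => B /independentP indB.
have [/subset_leq_card|/subsetPn[u uB]] :=
  boolP (B \subset [set u : 'I_n | (u < a)%N]).
  by rewrite card_ltn_ord.
rewrite inE => ua; apply: leq_trans a_gt0; rewrite -(cards1 u).
apply/subset_leq_card/subsetP => v vB; rewrite inE.
apply: contraTT (indB v u vB uB) => vu.
by rewrite negbK complete_split_adj vu (negPf ua) andbF.
Qed.

Theorem theorem3p1 (R : realType) :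
  (forall (n : nat) (G : sgraph n), (0 < n)%N -> connected_graph G ->
     let a := independence_number G in
     let m := eigen_count (distance_laplacian R G) (`[n%:R, (n + a)%:R[) in
     (m <= n - a)%N /\
     (a = 1%N \/ a = (n - 1)%N ->
        (m = (n - a)%N <->
         graph_iso G (complete_graph n) \/ graph_iso G (star_graph n)))) /\
  (forall n a : nat, (2 <= a <= n - 2)%N ->
     let G := complete_split_graph n a in
     [/\ connected_graph G,
         independence_number G = a &
         eigen_count (distance_laplacian R G) (`[n%:R, (n + a)%:R[) =
           (n - a)%N]).
Proof.
split=> [n G n_gt0 conG a m | n a /andP[a_ge2 a_le] G]; last first.
  have a_lt : (a < n)%N.
    apply: (leq_ltn_trans a_le); rewrite ltn_subrL /=.
    (* The case [n = 0] is excluded because the truncated difference [n - 2] would be 0,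
       contradicting [2 <= a]. *)
    by case: n a_le {G} => // /(leq_trans a_ge2).
  have cA := card_ltn_ord (ltnW a_lt).
  split; first exact: complete_split_connected.
    by rewrite complete_split_independence_number // (ltnW a_ge2) ltnW.
  rewrite -[in LHS]cA -[in RHS]cA; apply: eigen_count_complete_off.
  - exact: complete_split_indep.
  - by rewrite cA a_lt (ltnW a_ge2).
  - by move=> u v neq; rewrite !inE complete_split_adj neq.
have [A indA cA] := independence_number_attained G.
have A_gt0 : (0 < #|A|)%N by rewrite cA independence_number_gt0.
have m_le : (m <= n - a)%N by rewrite /m /a -cA eigen_count_le.
split=> // a_extr.
(* For these extreme values of [a], both sides of the equivalence are shown to hold outright. *)
suff [mE iso] : m = (n - a)%N /\
    (graph_iso G (complete_graph n) \/ graph_iso G (star_graph n)) by [].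
case: a_extr => aE.
  have adjE u v := independence_number1_adj u v aE.
  split; last first.
    by left; exists id => [|u v]; [exists id | rewrite adjE].
  (* For [n = 1] the set [A] is everything and the lower bound does not apply, but then [n - a = 0]
     and the upper bound already gives equality. *)
  have [n1|n_gt1] := leqP n 1.
    by apply/eqP; rewrite eqn_leq m_le aE (eqP (_ : n - 1 == 0)%N) // subn_eq0.
  rewrite /m /a -cA; apply: eigen_count_complete_off => //.
    by rewrite A_gt0 cA -/a aE.
  by move=> u v neq _; rewrite adjE.
have /cards1P[c Ac] : #|~: A| == 1%N.
  by rewrite cardsCs setCK card_ord cA -/a aE subKn.
have adjE := adj_compl_set1 conG indA Ac.
split; last by right; apply: star_iso adjE.
rewrite /m /a -cA; apply: eigen_count_complete_off => //.
  by rewrite A_gt0 cA -/a aE subn1 prednK /=.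
move=> u v neq uvA; rewrite adjE neq -!in_set1 -Ac !inE.
by rewrite -negb_and.
Qed.
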